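(* Let $n \ge 3$ and let $B_1,\dots,B_n \ge 1$ be real numbers, and put $V=\prod_{i=1}^n B_i$. Let $Q \in \mathbb{Z}[x_1,\dots,x_n]$ be any quadratic form, and let $N_1(Q,\mathbf{B})$ be the number of primitive vectors $\mathbf{x} \in \mathbb{Z}^n$ (i.e. $\gcd(x_1,\dots,x_n)=1$) with $|x_i| \le B_i$ for each $i$, $Q(\mathbf{x})=0$, and such that the projective point $[\mathbf{x}]$ does not lie on any line defined over $\mathbb{Q}$ that is contained in the projective hypersurface $\{Q=0\} \subset \mathbb{P}^{n-1}$. Then $$N_1(Q,\mathbf{B}) \le C_n\, V^{\frac{n-2}{n}},$$ where $C_n$ is a constant depending only on $n$.
   Context: A $\mathbb{Q}$-line contained in the hypersurface is a projective line in $\mathbb{P}^{n-1}$ defined over $\mathbb{Q}$ all of whose points satisfy $Q=0$. *)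

(* Defs.v *)
From HB Require Import structures.
From mathcomp Require Import all_boot all_order all_algebra all_field.
From mathcomp Require Import finmap.
From mathcomp Require Import boolp classical_sets functions cardinality.
From mathcomp Require Import reals exp.
From mathcomp Require Import zify.
(* The notations of mpoly clash with those of the analysis library. *)
From mathcomp Require Import -(notations) mpoly.

Set Implicit Arguments.
Unset Strict Implicit.
Unset Printing Implicit Defensive.

Import Order.TTheory GRing.Theory Num.Theory.

Local Open Scope classical_set_scope.
Local Open Scope ring_scope.

(* The zero form is included. *)
Definition quadratic_form (n : nat) (Q : mpoly n int) : bool :=
  Q \is ishomog1 2 mdeg.

Definition form_eval (n : nat) (A : comNzRingType) (Q : mpoly n int)
    (v : 'rV[A]_n) : A :=
  mmap (intr : int -> A) (fun i => v 0 i) Q.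

(* A projective line of P^(n-1) defined over rat is given by a 2 x n rational
   matrix of rank 2, whose rows span the corresponding plane; its geometric
   points are the classes of the nonzero vectors of the algC-span of the
   rows. *)
Definition on_line (n : nat) (L : 'M[rat]_(2, n)) (v : 'rV[algC]_n) : bool :=
  (v <= map_mx (ratr : rat -> algC) L)%MS.

Definition rational_line_in (n : nat) (Q : mpoly n int)
    (L : 'M[rat]_(2, n)) : Prop :=
  \rank L = 2%N /\
  forall v : 'rV[algC]_n, v != 0 -> on_line L v -> form_eval Q v = 0.

Definition primitive (n : nat) (x : 'rV[int]_n) : bool :=
  (\big[gcdn/0%N]_(i < n) `|x 0%R i|%N == 1)%N.

Definition N1_set (R : realType) (n : nat) (Q : mpoly n int)
    (B : 'I_n -> R) : set 'rV[int]_n :=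
  [set x | [/\ primitive x,
               forall i : 'I_n, (`|x 0 i|)%:~R <= B i,
               form_eval Q x = 0 &
               ~ exists L : 'M[rat]_(2, n),
                   rational_line_in Q L /\
                   on_line L (map_mx (intr : int -> algC) x)]].

Definition N1 (R : realType) (n : nat) (Q : mpoly n int)
    (B : 'I_n -> R) : nat :=
  #|` fset_set (N1_set Q B)|%fset.

(* fset_set sends infinite sets to the empty one, so N1 is a genuine
   cardinality thanks to this fact. *)
Lemma N1_set_finite (R : realType) (n : nat) (Q : mpoly n int)
    (B : 'I_n -> R) : finite_set (N1_set Q B).
Proof.
pose m : nat := \max_(i < n) Num.truncn (B i).
pose f (y : {ffun 'I_n -> 'I_(m.*2.+1)}) : 'rV[int]_n :=
  \row_i ((y i : nat)%:Z - m%:Z).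
apply: (sub_finite_set (B := f @` setT)); last first.
  exact/finite_image/finite_finset.
move=> x [_ xB _ _] /=.
have xm i : (`|x 0%R i| <= m)%N.
  apply: leq_trans (leq_bigmax i).
  have := xB i; rewrite -abszE -pmulrn => xBi.
  by rewrite truncn_ge_nat // (le_trans _ xBi).
exists [ffun i => inord (absz (x 0 i + m%:Z))] => //.
apply/rowP => i; rewrite !mxE ffunE inordK.
  have : - m%:Z <= x 0 i by have := xm i; lia.
  lia.
by have := xm i; lia.
Qed.

(* Main.v *)
(* A 2-adic descent. The points of a class are those congruent, up to scaling,
   to a fixed one modulo 2^k. If r is the rank of the ambient lattice and the
   quadric is smooth modulo 2 at the points of the class, such a class splits
   into at most 2^(r-2) classes modulo 2^(k+1), and the determinant of any r
   vectors in the span of a class is divisible by 2^(kr): besides the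
   congruence modulo 2^k, tangency gives a congruence modulo 4^k. So one step
   divides the ratio M between the volume of the box and the covolume of the
   lattice by 2^r and costs a factor 2^(r-2), which is what the bound
   M^((r-2)/r) allows.

   When the points of a class only span a space of dimension s < r, they are
   counted by induction on the rank. The points of the parent class span the
   whole space, hence complete a basis of the s-dimensional lattice inside the
   box, so that the ratio of that lattice is at most that of the parent; and
   (s-2)/s <= (r-2)/r. For s = 2, a projective line not contained in the quadric
   has at most two points on it.

   The points singular modulo 2 lie in a sublattice of even index on which the
   form is divisible by 2; this halves M, and the geometric series converges
   because (r-2)/r > 0. *)
Require Import Defs.
From mathcomp Require Import all_boot all_order all_algebra perm algC.
From mathcomp Require Import boolp cardinality reals exp.
From mathcomp Require Import finmap ring lra zify.
From mathcomp Require Import -(notations) mpoly.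

Import Order.TTheory GRing.Theory Num.Theory.
Local Open Scope ring_scope.

Set Implicit Arguments.
Unset Strict Implicit.
Unset Printing Implicit Defensive.

(** * Gram matrices of integral quadratic forms *)

(* With the Gram matrix [G] of a form [q], [bil G x x] is [2 * q x]. *)
Definition bil r (G : 'M[int]_r) (x y : 'rV[int]_r) : int :=
  (x *m G *m y^T) 0 0.

(** An even diagonal characterizes the forms [q] with integer coefficients, as [G i i] is twice the
    coefficient of a square. *)
Definition gram r (G : 'M[int]_r) : Prop :=
  G^T = G /\ forall i, (2 %| G i i)%Z.

Definition par r (x y : 'rV[int]_r) : Prop :=
  forall i j, x 0 i * y 0 j = x 0 j * y 0 i.

Definition prim r (x : 'rV[int]_r) : Prop :=
  forall (d : int) y, x = d *: y -> `|d|%N = 1%N.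

Lemma bilDl r (G : 'M[int]_r) x x' y : bil G (x + x') y = bil G x y + bil G x' y.
Proof. by rewrite /bil !mulmxDl mxE. Qed.

Lemma bilZl r (G : 'M[int]_r) a x y : bil G (a *: x) y = a * bil G x y.
Proof. by rewrite /bil -!scalemxAl mxE. Qed.

Lemma bilDr r (G : 'M[int]_r) x y y' : bil G x (y + y') = bil G x y + bil G x y'.
Proof. by rewrite /bil linearD mulmxDr mxE. Qed.

Lemma bilZr r (G : 'M[int]_r) a x y : bil G x (a *: y) = a * bil G x y.
Proof. by rewrite /bil linearZ /= -scalemxAr mxE. Qed.

Lemma bilBr r (G : 'M[int]_r) x y y' : bil G x (y - y') = bil G x y - bil G x y'.
Proof. by rewrite bilDr -scaleN1r bilZr mulN1r. Qed.

Lemma bil_tr r (G : 'M[int]_r) x y : bil G^T x y = bil G y x.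
Proof.
have E : (y *m G *m x^T)^T = x *m G^T *m y^T by rewrite !trmx_mul trmxK mulmxA.
by rewrite /bil -E mxE.
Qed.

Lemma bilC r (G : 'M[int]_r) x y : gram G -> bil G x y = bil G y x.
Proof. by case=> Gs _; rewrite -[in LHS]Gs bil_tr. Qed.

Lemma bilM r s (G : 'M[int]_r) (F : 'M[int]_(s, r)) x y :
  bil (F *m G *m F^T) x y = bil G (x *m F) (y *m F).
Proof. by rewrite /bil trmx_mul !mulmxA. Qed.

Lemma bil_scale r (G : 'M[int]_r) c x y : bil (c *: G) x y = c * bil G x y.
Proof. by rewrite /bil -scalemxAr -scalemxAl mxE. Qed.

Lemma bil_delta r (G : 'M[int]_r) i j :
  bil G (delta_mx 0 i) (delta_mx 0 j) = G i j.
Proof. by rewrite /bil -rowE trmx_delta -colE !mxE. Qed.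

Lemma bilE r (G : 'M[int]_r) x y : bil G x y = \sum_i (x *m G) 0 i * y 0 i.
Proof. by rewrite /bil mxE; apply: eq_bigr => i _; rewrite [y^T _ _]mxE. Qed.

(** Splitting [G] as [U + U^T], with [U] upper triangular and the diagonal halved, makes [bil G x x]
    twice an integer. *)
Lemma bil_even r (G : 'M[int]_r) x : gram G -> (2 %| bil G x x)%Z.
Proof.
move=> [Gs Gd].
pose U : 'M[int]_r :=
  \matrix_(i, j) (if (i < j)%N then G i j else if i == j then (G i i %/ 2)%Z else 0).
have -> : G = U + U^T.
  apply/matrixP => i j; rewrite !mxE; case: ltngtP => // [ij|ij|/ord_inj <-].
  - rewrite -(inj_eq val_inj) /= gtn_eqF // addr0 //.
  - by rewrite -[in LHS]Gs mxE -(inj_eq val_inj) /= gtn_eqF // add0r.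
  - by rewrite eqxx; have := Gd i; lia.
have -> : bil (U + U^T) x x = 2 * bil U x x.
  have -> : bil (U + U^T) x x = bil U x x + bil U^T x x.
    by rewrite /bil mulmxDr mulmxDl mxE.
  by rewrite bil_tr; ring.
by rewrite dvdz_mulr.
Qed.

Lemma gram_half r (G : 'M[int]_r) c :
  c != 0 -> (forall i j, (c %| G i j)%Z) -> (forall i, (2 * c %| G i i)%Z) ->
  G^T = G -> exists2 G' : 'M[int]_r, gram G' & G = c *: G'.
Proof.
move=> c0 cG cGd Gs; exists (\matrix_(i, j) (G i j %/ c)%Z).
  split=> [|i]; first by apply/matrixP => i j; rewrite !mxE -[in LHS]Gs mxE.
  by rewrite mxE; case/dvdzP: (cGd i) => q ->; rewrite mulrA mulzK // dvdz_mull.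
by apply/matrixP => i j; rewrite !mxE mulrC divzK.
Qed.

Lemma prim_neq0 r (x : 'rV[int]_r) : prim x -> x != 0.
Proof.
move=> px; apply/eqP => x0; have := px 0 0.
by rewrite scaler0 x0 => /(_ erefl).
Qed.

Lemma parE r (x y : 'rV[int]_r) i : par x y -> x 0 i *: y = y 0 i *: x.
Proof. by move=> xy; apply/rowP => j; rewrite !mxE xy mulrC. Qed.

Lemma parS r (x y : 'rV[int]_r) : par x y -> par y x.
Proof. by move=> xy i j; rewrite mulrC -xy mulrC. Qed.

Lemma rv_neq0P r (x : 'rV[int]_r) : x != 0 -> exists i, x 0 i != 0.
Proof.
move=> x0; apply/existsP; apply: contra_neqT x0 => /existsPn h.
by apply/rowP => i; rewrite mxE; apply/eqP; have := h i; rewrite negbK.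
Qed.

Lemma dvd_row r (x : 'rV[int]_r) d :
  (forall j, (d %| x 0%R j)%Z) -> exists y, x = d *: y.
Proof.
move=> dx; exists (\row_j (x 0%R j %/ d)%Z).
by apply/rowP => j; rewrite !mxE mulrC divzK.
Qed.

Lemma scaler_int_inj m r (c : int) : c != 0 ->
  injective (fun A : 'M[int]_(m, r) => c *: A).
Proof.
by move=> c0 x y /matrixP xy; apply/matrixP => i j; have := xy i j;
   rewrite !mxE => /(mulfI c0).
Qed.

(** With the ratio of the two vectors in lowest terms, [a *: y = b *: x], coprimality forces [a] to
    divide [x] and [b] to divide [y], so both are units. *)
Lemma par_prim r (x y : 'rV[int]_r) :
  prim x -> prim y -> par x y -> y = x \/ y = - x.
Proof.
move=> px py xy.
have [i xi0] := rv_neq0P (prim_neq0 px).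
have := parE i xy; set u := x 0 i; set v := y 0 i => uv.
set g := gcdz u v.
have g0 : g != 0 by rewrite gcdz_eq0 (negbTE xi0).
have [a ua] : exists a, u = a * g by apply/dvdzP/dvdz_gcdl.
have [b vb] : exists b, v = b * g by apply/dvdzP/dvdz_gcdr.
have cop : coprimez a b.
  have : gcdz u v = g by [].
  rewrite ua vb -mulz_gcdl /coprimez => E.
  have gg : `|g|%N%:Z = g by [].
  by apply/eqP/(mulIf g0); rewrite mul1r -[X in _ * X]gg.
have ab : a *: y = b *: x.
  by apply: (scaler_int_inj g0); rewrite !scalerA ![g * _]mulrC -ua -vb.
have [x' xE] : exists x', x = a *: x'.
  apply: dvd_row => j; rewrite -(Gauss_dvdzr _ cop).
  by move/rowP/(_ j): ab; rewrite !mxE => <-; rewrite dvdz_mulr.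
have [y' yE] : exists y', y = b *: y'.
  apply: dvd_row => j; rewrite coprimez_sym in cop; rewrite -(Gauss_dvdzr _ cop).
  by move/rowP/(_ j): ab; rewrite !mxE => ->; rewrite dvdz_mulr.
have a1 := px _ _ xE; have b1 := py _ _ yE.
have [] : a = 1 \/ a = -1 by lia.
  move=> aE; have [bE|bE] : b = 1 \/ b = -1 by lia.
    by left; move: ab; rewrite aE bE !scale1r.
  by right; move: ab; rewrite aE bE scale1r scaleN1r.
move=> aE; have [bE|bE] : b = 1 \/ b = -1 by lia.
  by right; move: ab; rewrite aE bE scale1r scaleN1r => <-; rewrite opprK.
by left; move: ab; rewrite aE bE !scaleN1r => /oppr_inj.
Qed.

(** * Admissible points, covolumes, and the case of rank at most 2 *)

Section Nodes.
Variables (R : realType) (n : nat) (B : 'I_n -> R).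

Definition in_box r (E : 'M[int]_(r, n)) (x : 'rV[int]_r) : Prop :=
  forall j, (`|(x *m E) 0 j|)%:~R <= B j.

(* As [x] is isotropic, the last condition says that no plane containing [x] is
   totally isotropic. *)
Definition good r (E : 'M[int]_(r, n)) (G : 'M[int]_r) (x : 'rV[int]_r) : Prop :=
  [/\ in_box E x, prim x, bil G x x = 0 &
      forall y, bil G x y = 0 -> bil G y y = 0 -> par x y].

(* The maximal minors of [E] are its Pluecker coordinates, so this bounds below
   by [r`! / M] the covolume of the lattice with basis [E], for the norm with
   unit ball the box. The factorial makes the bound stable under [vol_del_row]
   and gives [1 <= M] once the box contains [r] independent vectors. *)
Definition vol r (E : 'M[int]_(r, n)) (M : R) : Prop :=
  exists f : 'I_r -> 'I_n,
    (r`!)%:R * \prod_i B (f i) <= M * (`|\det (colsub f E)|)%:~R.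

Definition spans r (S : seq 'rV[int]_r) : Prop :=
  exists2 X : 'M[int]_r, \det X != 0 & forall i, row i X \in S.

(** If [x] and [y] are independent points, [bil G x y] is nonzero, and isotropy of a third point
    kills one of its two coefficients: only [x], [y] and their opposites remain. Without such a
    pair, one point and its opposite are all. *)
Lemma size_good_rank_le2 r (E : 'M[int]_(r, n)) (G : 'M[int]_r) (S : seq 'rV[int]_r) :
  (r <= 2)%N -> gram G -> uniq S -> (forall x, x \in S -> good E G x) ->
  (size S <= 4)%N.
Proof.
move=> r2 gG uS gS.
case: (pselect (exists x y, [/\ x \in S, y \in S & ~ par x y])); last first.
  move=> hpar; case: S uS gS hpar => // x S' uS gS hpar.
  have sub : {subset x :: S' <= [:: x; - x]}.
    move=> y yS; rewrite !inE; have xS : x \in x :: S' by rewrite inE eqxx.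
    have xy : par x y.
      by apply: contra_notP hpar => nxy; exists x, y.
    have [_ px _ _] := gS _ xS; have [_ py _ _] := gS _ yS.
    by case: (par_prim px py xy) => ->; rewrite eqxx ?orbT.
  by apply: leq_trans (uniq_leq_size uS sub) _.
move=> [x [y [xS yS nxy]]].
have r2E : r = 2%N.
  apply/eqP; rewrite eqn_leq r2 /=; rewrite ltnNge; apply/negP => r1; apply: nxy => i j.
  have -> : i = j by apply: ord_inj; have := ltn_ord i; have := ltn_ord j; lia.
  by rewrite mulrC.
subst r.
have [_ px x0 NLx] := gS _ xS; have [_ py y0 _] := gS _ yS.
have bxy : bil G x y != 0 by apply/eqP => /NLx /(_ y0).
have sub : {subset S <= [:: x; - x; y; - y]}.
  move=> z zS; have [_ pz z0 _] := gS _ zS; rewrite !inE.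
  pose d (u v : 'rV[int]_2) := u 0 0 * v 0 1 - u 0 1 * v 0 0.
  have d0 u v : d u v = 0 -> par u v.
    move=> duv i j.
    have two (k : 'I_2) : k = 0 \/ k = 1.
      by case: k => [[|[|//]] ?]; [left|right]; apply: val_inj.
    by case: (two i) => ->; case: (two j) => ->;
       rewrite 1?mulrC //; move: duv; rewrite /d; lia.
  (* Cramer's rule, [d] being the determinant of two vectors. *)
  have cr : d x y *: z = d z y *: x + d x z *: y.
    apply/rowP => i; rewrite !mxE.
    have [->|->] : i = 0 \/ i = 1.
      by case: i => [[|[|//]] ?]; [left|right]; apply: val_inj.
    - by rewrite /d; ring.
    - by rewrite /d; ring.
  have := congr1 (fun w => bil G w w) cr.
  rewrite /= !(bilZl, bilZr, bilDl, bilDr) x0 y0 z0 (bilC y x gG) => h.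
  have : 2 * (d z y * d x z * bil G x y) = 0 by move: h; rewrite !mulr0 => ->; ring.
  move/eqP; rewrite !mulf_eq0 (negbTE bxy) orbF /= => /orP [/eqP/d0|/eqP/d0] hp.
  - by case: (par_prim py pz (parS hp)) => ->; rewrite eqxx ?orbT.
  - by case: (par_prim px pz hp) => ->; rewrite eqxx ?orbT.
by apply: leq_trans (uniq_leq_size uS sub) _.
Qed.

End Nodes.

(** * Bases of spans of integer vectors *)

Notation mxQ := (map_mx (intr : int -> rat)).

Definition submod r (Lam : 'rV[int]_r -> Prop) : Prop :=
  Lam 0 /\ forall a x y, Lam x -> Lam y -> Lam (a *: x + y).

Lemma submod_mul r m (Lam : 'rV[int]_r -> Prop) (u : 'rV[int]_m) (A : 'M[int]_(m, r)) :
  submod Lam -> (forall i, Lam (row i A)) -> Lam (u *m A).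
Proof.
move=> [L0 LD] LA; rewrite mulmx_sum_row.
apply: (big_ind Lam) => // [x y Lx Ly|i _]; first by rewrite -[x]scale1r; apply: LD.
by rewrite -[_ *: _]addr0; apply: LD.
Qed.

Lemma det_mxQ r (A : 'M[int]_r) : (\det (mxQ A) == 0) = (\det A == 0).
Proof. by rewrite det_map_mx intr_eq0. Qed.

Lemma row_freeQ_inj s r (F : 'M[int]_(s, r)) (y : 'rV[int]_s) :
  row_free (mxQ F) -> y *m F = 0 -> y = 0.
Proof.
move=> Ff yF; have : mxQ y *m mxQ F = 0 by rewrite -map_mxM yF map_mx0.
rewrite -[RHS](mul0mx _ (mxQ F)) => /(row_free_inj Ff) /rowP y0.
by apply/rowP => i; have := y0 i; rewrite !mxE => /eqP; rewrite intr_eq0 => /eqP.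
Qed.

(** In a Smith normal form, the first rows of [Q], scaled by the nonzero invariant factors, form a
    basis [F] of the integer span; [S'] lists the coordinates in it. The last clause passes linear
    conditions from the points to the basis. *)
Lemma zspan_basis r (S : seq 'rV[int]_r) :
  exists (s : nat) (F : 'M[int]_(s, r)) (S' : seq 'rV[int]_s),
    [/\ (s <= r)%N, row_free (mxQ F), map (fun t => t *m F) S' = S, spans S' &
     forall Lam, submod Lam -> (forall x, x \in S -> Lam x) ->
       forall i, Lam (row i F)].
Proof.
have unitQ k (C : 'M[int]_k) : C \in unitmx -> mxQ C \in unitmx.
  by rewrite !unitmxE unitfE det_mxQ; apply: contraTneq => ->; rewrite unitr0.
pose m := size S; pose A : 'M[int]_(m, r) := \matrix_i nth 0 S i.
have [L uL [Q uQ [d dS AE]]] := int_Smith_normal_form A.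
set D := (\matrix_(i, j) _ : 'M_(m, r)) in AE.
pose p := [seq d`_i | i <- iota 0 (minn m r)].
(* The number of nonzero invariant factors: by divisibility, all those after the first zero
   vanish. *)
pose s := find (pred1 0) p.
have sz_p : size p = minn m r by rewrite size_map size_iota.
have sm : (s <= minn m r)%N by rewrite -sz_p find_size.
have dn0 i : (i < s)%N -> d`_i != 0.
  move=> is_; have := before_find 0 is_.
  rewrite (nth_map 0%N) ?size_iota ?(leq_trans is_) // nth_iota ?(leq_trans is_) //=.
  by move=> /negbT.
have d0 i : (s <= i)%N -> (i < minn m r)%N -> d`_i = 0.
  move=> si im; have sp : (s < size p)%N by rewrite sz_p (leq_ltn_trans si).
  have := sp; rewrite -has_find => /(nth_find 0).
  rewrite (nth_map 0%N) ?size_iota -?sz_p // nth_iota -?sz_p //= -/s => /eqP ds.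
  have [id|id] := ltnP i (size d); last by rewrite nth_default.
  have : (d`_s %| d`_i)%Z.
    apply: (sorted_leq_nth dvdz_trans dvdzz 0 dS) => //.
    by rewrite inE (leq_ltn_trans si).
  by rewrite ds dvd0z => /eqP.
have sm1 : (s <= m)%N by apply: leq_trans sm (geq_minl _ _).
have sr : (s <= r)%N by apply: leq_trans sm (geq_minr _ _).
pose dg : 'M[int]_s := diag_mx (\row_k d`_k).
pose Z : 'M[int]_(m, s) := L *m pid_mx s.
pose F : 'M[int]_(s, r) := dg *m pid_mx s *m Q.
have pidD : (pid_mx s : 'M[int]_(s, m)) *m D = dg *m pid_mx s.
  apply/matrixP => i j; rewrite mul_diag_mx [LHS]mxE [RHS]mxE (bigD1 (widen_ord sm1 i)) //=.
  rewrite !mxE /= eqxx ltn_ord mul1r big1 ?addr0 => [|k ki].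
    by rewrite andbT mulrb; case: eqP => _; rewrite ?mulr1 ?mulr0.
  rewrite !mxE; case: eqP => [ik|_]; last by rewrite mul0r.
  by case/eqP: ki; apply: val_inj.
have Dpid : (pid_mx s : 'M[int]_(m, s)) *m (dg *m pid_mx s) = D.
  rewrite -pidD; apply/matrixP => i j; rewrite mulmxA mul_pid_mx !minnn.
  rewrite mxE (bigD1 i) //= big1 ?addr0 => [|k ki]; last first.
    by rewrite !mxE eq_sym (inj_eq val_inj) (negbTE ki) /= mul0r.
  rewrite !mxE eqxx /=; case: ltnP => is_; rewrite ?mul1r // mul0r.
  case: eqP => //= ij; rewrite d0 ?mul0rn // leq_min ltn_ord /=.
  by rewrite ij ltn_ord.
have AZF : A = Z *m F by rewrite AE /Z /F -Dpid !mulmxA.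
have FA : F = (pid_mx s *m invmx L) *m A.
  by rewrite AE !mulmxA -[_ *m invmx L *m L]mulmxA mulVmx // mulmx1 pidD.
have SA : [seq row i A | i <- enum 'I_m] = S.
  have -> : [seq row i A | i <- enum 'I_m] = [seq nth 0 S (val i) | i <- enum 'I_m].
    by apply: eq_map => i; rewrite rowK.
  by rewrite (map_comp (nth 0 S) val) val_enum_ord map_nth_iota0 // take_size.
exists s, F, [seq row i Z | i <- enum 'I_m]; split=> //.
- have uQ' : row_free (mxQ Q) by rewrite row_free_unit unitQ.
  have pf : row_free (pid_mx s : 'M[rat]_(s, r)) by rewrite /row_free rank_pid_mx.
  rewrite /F !map_mxM /= map_pid_mx /row_free !mxrankMfree //.
  rewrite -/(row_free _) row_free_unit unitmxE unitfE det_mxQ det_diag.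
  by apply/prodf_neq0 => i _; rewrite mxE dn0.
- rewrite -map_comp; apply: etrans SA; apply: eq_map => i /=.
  by rewrite AZF [RHS]row_mul.
- have Zf : row_full (mxQ Z).
    rewrite /row_full /Z map_mxM map_pid_mx (eqmxMfull _ _) ?rank_pid_mx //.
    by rewrite row_full_unit unitQ.
  exists (rowsub (fullrankfun Zf) Z) => [|i].
    have := fullrowsub_unit Zf; rewrite -map_mxsub unitmxE unitfE det_mxQ //.
  by rewrite row_rowsub; apply/map_f/mem_enum.
move=> Lam LamS LS i; rewrite FA row_mul; apply: submod_mul => // j.
by apply: LS; rewrite rowK mem_nth.
Qed.

(** * Volumes *)

Lemma intr_abs (R : realType) (a : int) : (`|a|)%:~R = `|a%:~R| :> R.
Proof. by rewrite intr_norm. Qed.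

Lemma det_box (R : realType) r (A : 'M[int]_r) (b : 'I_r -> R) :
  (forall i j, (`|A i j|)%:~R <= b j) ->
  (`|\det A|)%:~R <= (r`!)%:R * \prod_i b i.
Proof.
move=> Ab; rewrite intr_abs /determinant rmorph_sum /=.
apply: le_trans (ler_norm_sum _ _ _) _.
have -> : (r`!)%:R * \prod_i b i = \sum_(s : {perm 'I_r}) \prod_i b i.
  by rewrite sumr_const -card_Sn mulr_natl.
apply: ler_sum => s _; rewrite rmorphM rmorph_prod normrM /= rmorphXn /= rmorphN rmorph1.
rewrite normrX normrN1 expr1n mul1r normr_prod [X in _ <= X](reindex_inj (@perm_inj _ s)) /=.
by apply: ler_prod => i _; rewrite normr_ge0 -intr_abs Ab.
Qed.

Section Volume.
Variables (R : realType) (n : nat) (B : 'I_n -> R).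
Hypothesis B0 : forall i, 0 < B i.

Lemma prodB_gt0 r (f : 'I_r -> 'I_n) : 0 < (r`!)%:R * \prod_i B (f i).
Proof. by rewrite mulr_gt0 ?ltr0n ?fact_gt0 // prodr_gt0. Qed.

Lemma colsub_mul r s m (F : 'M[int]_(s, r)) (E : 'M[int]_(r, n)) (f : 'I_m -> 'I_n) :
  colsub f (F *m E) = F *m colsub f E.
Proof. by apply/matrixP => i j; rewrite !mxE; apply: eq_bigr => k _; rewrite !mxE. Qed.

(** The determinant of [X] times a maximal minor of [E] is a minor of [X *m E], whose rows lie in
    the box, so [det_box] applies to it. *)
Lemma vol_ge_det r (E : 'M[int]_(r, n)) (X : 'M[int]_r) M :
  (forall i, in_box B E (row i X)) -> 0 <= M -> vol B E M ->
  (`|\det X|)%:~R <= M.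
Proof.
move=> Xb M0 [f hf]; have p0 := prodB_gt0 f.
have E0 : 0 < (`|\det (colsub f E)|)%:~R :> R.
  rewrite ltNge; apply/negP => h.
  by have := lt_le_trans p0 (le_trans hf (mulr_ge0_le0 M0 h)); rewrite ltxx.
rewrite -(ler_pM2r E0); apply: le_trans hf.
rewrite -rmorphM /= -normrM -det_mulmx -colsub_mul; apply: det_box => i j.
by rewrite mxE; have := Xb i (f j); rewrite -row_mul mxE.
Qed.

Lemma vol_mul r (E : 'M[int]_(r, n)) (F : 'M[int]_r) M q :
  (0 < q)%N -> 0 <= M -> (q <= `|\det F|)%N -> vol B E M -> vol B (F *m E) (M / q%:R).
Proof.
move=> q0 M0 qF [f hf]; exists f; apply: le_trans hf _.
rewrite colsub_mul det_mulmx normrM rmorphM /= mulrA; apply: ler_wpM2r.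
  by rewrite ler0z.
rewrite -mulrA ler_peMr // mulrC ler_pdivlMr ?ltr0n // mul1r.
by rewrite -abszE -pmulrn ler_nat.
Qed.

(* Laplace expansion along the row [i]. *)
Lemma vol_del_row r (E : 'M[int]_(r.+1, n)) (i : 'I_r.+1) M :
  (forall j, (`|E i j|)%:~R <= B j) -> 0 <= M -> vol B E M -> vol B (row' i E) M.
Proof.
move=> Ei M0 [f hf]; apply: contrapT => nv.
have lt j : M * (`|\det (colsub (fun k => f (lift j k)) (row' i E))|)%:~R
    < (r`!)%:R * \prod_k B (f (lift j k)).
  by rewrite ltNge; apply/negP => h; apply: nv; eexists; exact: h.
have : ((r.+1)`!)%:R * \prod_j B (f j) < ((r.+1)`!)%:R * \prod_j B (f j).
  apply: le_lt_trans hf _.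
  rewrite (expand_det_row _ i) intr_abs rmorph_sum /=.
  apply: (@le_lt_trans _ _ (\sum_(j < r.+1) B (f j) *
     (M * (`|\det (colsub (fun k => f (lift j k)) (row' i E))|)%:~R))).
    apply: (le_trans (ler_wpM2l M0 (ler_norm_sum _ _ _))).
    rewrite mulr_sumr; apply: ler_sum => j _.
    rewrite rmorphM normrM mulrCA; apply: ler_pM => //.
    - by rewrite mulr_ge0.
    - by rewrite -intr_abs mxE Ei.
    apply: ler_wpM2l => //.
    rewrite /cofactor rmorphM normrM /= rmorphXn /= rmorphN rmorph1 normrX normrN1.
    rewrite expr1n mul1r intr_abs; rewrite le_eqVlt; apply/orP; left; apply/eqP; congr (`|(\det _)%:~R|).
    by apply/matrixP => u v; rewrite !mxE.
  (* All [r.+1] terms are equal, and their number turns the factorial of [r] into that of [r.+1]. *)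
  have -> : ((r.+1)`!)%:R * \prod_j B (f j) =
      \sum_(j < r.+1) B (f j) * ((r`!)%:R * \prod_k B (f (lift j k))).
    rewrite [RHS](eq_bigr (fun=> (r`!)%:R * \prod_j B (f j))) => [|j _].
      by rewrite /= sumr_const card_ord factS natrM -mulrA mulr_natl.
    by rewrite mulrCA [in RHS](@bigD1_ord _ _ _ _ j).
  apply: ltr_sum => [|j _]; last by rewrite ltr_pM2l.
  by apply/hasP; exists ord0; rewrite ?mem_index_enum.
by rewrite ltxx.
Qed.
End Volume.

(** * Passing to a sublattice of smaller rank *)

Section Drop.
Variables (R : realType) (n : nat).

(* Both the truncated subtraction and [x / 0 = 0] matter: the value is 0 for
   [r <= 2]. *)
Definition theta (r : nat) : R := (r - 2)%N%:R / r%:R.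

Lemma theta_ge0 r : 0 <= theta r.
Proof. by rewrite divr_ge0. Qed.

Lemma theta_homo s r : (s <= r)%N -> theta s <= theta r.
Proof.
case: s => [|[|[|s]]] sr; rewrite /theta ?mul0r ?theta_ge0 //.
case: r sr => [|[|[|r]]] // sr.
rewrite ler_pdivrMr // mulrAC ler_pdivlMr // -!natrM ler_nat; nia.
Qed.

Definition bound r (C : R) : Prop :=
  forall (B : 'I_n -> R) (E : 'M[int]_(r, n)) (G : 'M[int]_r)
         (S : seq 'rV[int]_r) (M : R),
    (forall i, 0 < B i) -> gram G -> 0 <= M -> vol B E M -> uniq S ->
    (forall x, x \in S -> good B E G x) -> spans S ->
    (size S)%:R <= C * M `^ theta r.

Lemma bound_le r C C' : C <= C' -> bound r C -> bound r C'.
Proof.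
move=> CC' bC B E G S M *; apply: (le_trans (bC B E G S M _ _ _ _ _ _ _)) => //.
by apply: ler_wpM2r => //; exact: powR_ge0.
Qed.

Lemma bound_small r : (r <= 2)%N -> bound r 4.
Proof.
move=> r2 B E G S M _ gG _ _ uS gS _.
have -> : theta r = 0 by rewrite /theta; move: r2; rewrite -subn_eq0 => /eqP ->; rewrite mul0r.
by rewrite powRr0 mulr1 (ler_nat _ _ 4) (size_good_rank_le2 r2 gG uS gS).
Qed.

Variables (B : 'I_n -> R).
Hypothesis B0 : forall i, 0 < B i.

Lemma gram_sub s r (F : 'M[int]_(s, r)) (G : 'M[int]_r) :
  gram G -> gram (F *m G *m F^T).
Proof.
move=> gG; split=> [|i]; first by rewrite !trmx_mul trmxK (proj1 gG) mulmxA.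
by rewrite -bil_delta bilM bil_even.
Qed.

(** A totally isotropic plane through [t] maps to one through [t *m F], whatever the scaling [c];
    injectivity of [F] brings proportionality back. *)
Lemma good_sub s r (F : 'M[int]_(s, r)) (E : 'M[int]_(r, n)) (G : 'M[int]_r)
    (G' : 'M[int]_s) c t :
  row_free (mxQ F) -> c != 0 -> F *m G *m F^T = c *: G' ->
  good B E G (t *m F) -> good B (F *m E) G' t.
Proof.
move=> Ff c0 GE [tb tp t0 NL].
have bE x y : bil G (x *m F) (y *m F) = c * bil G' x y by rewrite -bilM GE bil_scale.
split.
- by move=> j; have := tb j; rewrite mulmxA.
- by move=> d y tE; apply: (tp d (y *m F)); rewrite tE scalemxAl.
- by move: t0; rewrite bE => /eqP; rewrite mulf_eq0 (negbTE c0) => /eqP.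
move=> y ty yy; have tyF : par (t *m F) (y *m F) by apply: NL; rewrite bE ?ty ?yy mulr0.
have [i ti] := rv_neq0P (prim_neq0 tp).
have := parE i tyF; rewrite !scalemxAl => /eqP; rewrite -subr_eq0 -mulmxBl => /eqP.
move=> /(row_freeQ_inj Ff) /eqP; rewrite subr_eq0 => /eqP /rowP h j k.
apply: (mulfI ti); have := h k; have := h j; rewrite !mxE => hj hk.
by rewrite mulrCA hk mulrCA [RHS]mulrCA hj; ring.
Qed.

Lemma row_freeQ_extend s r (F : 'M[int]_(s, r)) (X : 'M[int]_r) :
  (s < r)%N -> row_free (mxQ F) -> \det X != 0 ->
  exists i, row_free (mxQ (col_mx (row i X) F)).
Proof.
move=> sr Ff X0; apply: contrapT => h.
have XF : (mxQ X <= mxQ F)%MS.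
  apply/row_subP => i; apply: contrapT => /negP ni; apply: h; exists i.
  rewrite map_col_mx map_row -row_leq_rank.
  have : (mxQ F < row i (mxQ X) + mxQ F)%MS by rewrite ltmxE addsmxSr addsmx_sub submx_refl andbT.
  by move=> /rank_ltmx; rewrite addsmxE (eqP Ff).
have rX : \rank (mxQ X) = r.
  by apply: mxrank_unit; rewrite unitmxE unitfE det_mxQ.
by have := mxrankS XF; rewrite rX (eqP Ff) leqNgt sr.
Qed.

(** Induction on the corank [d]. Rows of [X] complete [F] to full rank, where divisibility by [q]
    bounds the index below; removing them again costs nothing because they lie in the box. *)
Lemma vol_drop r (E : 'M[int]_(r, n)) (M : R) (X : 'M[int]_r) (Lam : 'rV[int]_r -> Prop) q :
  0 <= M -> vol B E M -> \det X != 0 -> (forall i, in_box B E (row i X)) ->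
  (forall i, Lam (row i X)) -> (0 < q)%N ->
  (forall Y : 'M[int]_r, (forall i, Lam (row i Y)) -> (q %| \det Y)%Z) ->
  forall d s (F : 'M[int]_(s, r)), (s + d = r)%N -> row_free (mxQ F) ->
    (forall i, Lam (row i F)) -> vol B (F *m E) (M / q%:R).
Proof.
move=> M0 vE X0 Xb XL q0 Lq; elim=> [|d IH] s F.
  rewrite addn0 => sr; subst s => Ff FL; apply: vol_mul => //.
  have : (q %| \det F)%Z by exact: Lq.
  rewrite dvdzE /= => /dvdn_leq; apply.
  by rewrite absz_gt0 -det_mxQ -unitfE -unitmxE -row_free_unit.
rewrite addnS -addSn => sdr Ff FL.
have sr : (s < r)%N by rewrite -sdr leq_addr.
have [i Fi] := row_freeQ_extend sr Ff X0.
pose C : 'M[int]_(s.+1, r) := @col_mx _ 1 s r (row i X) F.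
have := IH _ C sdr Fi.
have C0 : row 0 C = row i X.
  have e0 : 0 = @lshift 1 s 0 :> 'I_s.+1 by exact: val_inj.
  by apply/rowP => k; rewrite mxE e0; exact: (@col_mxEu _ 1 s r).
have CS k : row (lift 0 k) C = row k F.
  have ek : lift 0 k = @rshift 1 s k :> 'I_s.+1 by exact: val_inj.
  apply/rowP => j; rewrite mxE ek [RHS]mxE; exact: (@col_mxEd _ 1 s r).
have -> : F *m E = row' 0 (C *m E).
  apply/row_matrixP => k; rewrite row_mul -CS -row_mul.
  by apply/rowP => j; rewrite !mxE.
move=> vF; apply: vol_del_row => //.
- move=> j; have := Xb i j; rewrite -C0 -row_mul mxE //.
- by rewrite divr_ge0.
apply: vF => j; case: (unliftP 0 j) => [k ->|->]; last by rewrite C0.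
by rewrite CS.
Qed.

(** Either the span has smaller rank, and the bound for that rank applies to a basis of it, or the
    basis has rank [r] and is returned for further descent. *)
Lemma drop_or_full r (C : R) (E : 'M[int]_(r, n)) (G : 'M[int]_r) (S : seq 'rV[int]_r) (M : R)
    (X : 'M[int]_r) (Lam : 'rV[int]_r -> Prop) q :
  0 <= C -> (forall s, (s < r)%N -> bound s C) ->
  gram G -> 0 <= M -> vol B E M -> uniq S -> (forall x, x \in S -> good B E G x) ->
  \det X != 0 -> (forall i, in_box B E (row i X)) ->
  submod Lam -> (forall i, Lam (row i X)) -> (forall x, x \in S -> Lam x) ->
  (0 < q)%N -> (forall Y : 'M[int]_r, (forall i, Lam (row i Y)) -> (q %| \det Y)%Z) ->
  (size S)%:R <= C * (M / q%:R) `^ theta r \/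
  exists (F : 'M[int]_r) (S' : seq 'rV[int]_r),
    [/\ row_free (mxQ F), map (fun t => t *m F) S' = S, spans S' &
     forall Lam', submod Lam' -> (forall x, x \in S -> Lam' x) ->
       forall i, Lam' (row i F)].
Proof.
move=> C0 Cs gG M0 vE uS gS X0 Xb Ls LX LS q0 Lq.
have [s [F [S' [sr Ff SE [T T0 TS'] FL]]]] := zspan_basis S.
move: sr; rewrite leq_eqVlt => /orP [/eqP sr|sr]; [right|left].
  by subst s; exists F, S'; split=> //; exists T.
have {}FL : forall i, Lam (row i F) by apply: FL.
have vF : vol B (F *m E) (M / q%:R).
  by apply: (vol_drop M0 vE X0 Xb LX q0 Lq (subnKC (ltnW sr))).
have gS' t : t \in S' -> good B (F *m E) (F *m G *m F^T) t.
  move=> tS'; apply: (@good_sub _ _ F E G _ 1) => //; first by rewrite scale1r.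
  by apply: gS; rewrite -SE; apply: map_f.
have Mq0 : 0 <= M / q%:R by rewrite divr_ge0.
have := Cs _ sr B (F *m E) _ S' _ B0 (gram_sub F gG) Mq0 vF _ gS' (ex_intro2 _ _ T T0 TS').
rewrite -SE size_map => h; apply: le_trans (h _) _.
  by move: uS; rewrite -SE; apply: map_uniq.
(* Raising the exponent to [theta r] needs a base at least 1, provided by the nonzero integer
   [\det T]. *)
apply: ler_wpM2l => //; apply: ler_powR; last exact/theta_homo/ltnW.
apply: le_trans (vol_ge_det B0 (X := T) _ Mq0 vF).
  by rewrite ler1z -gtz0_ge1 normr_gt0.
by move=> i; case: (gS' _ (TS' i)).
Qed.
Lemma drop_rank r (C : R) (E : 'M[int]_(r, n)) (G : 'M[int]_r) (S : seq 'rV[int]_r) (M : R)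
    (X : 'M[int]_r) (Lam : 'rV[int]_r -> Prop) q :
  0 <= C -> (forall s, (s < r)%N -> bound s C) ->
  gram G -> 0 <= M -> vol B E M -> uniq S -> (forall x, x \in S -> good B E G x) ->
  \det X != 0 -> (forall i, in_box B E (row i X)) ->
  submod Lam -> (forall i, Lam (row i X)) -> (forall x, x \in S -> Lam x) ->
  (0 < q)%N -> (forall Y : 'M[int]_r, (forall i, Lam (row i Y)) -> (q %| \det Y)%Z) ->
  ~ spans S -> (size S)%:R <= C * (M / q%:R) `^ theta r.
Proof.
move=> C0 Cs gG M0 vE uS gS X0 Xb Ls LX LS q0 Lq nsp.
have [//|[F [S' [Ff SE [T T0 TS'] _]]]] :=
  drop_or_full C0 Cs gG M0 vE uS gS X0 Xb Ls LX LS q0 Lq.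
case: nsp; exists (T *m F) => [|i].
  by rewrite det_mulmx mulf_neq0 // -det_mxQ -unitfE -unitmxE -row_free_unit.
by rewrite -SE row_mul; apply: map_f.
Qed.
End Drop.

(** * Congruence classes *)

Lemma dvdz_add (d a b : int) : (d %| a)%Z -> (d %| b)%Z -> (d %| a + b)%Z.
Proof. exact: rpredD. Qed.

Lemma evenF2 a : (2 %| a)%Z = (a%:~R == 0 :> 'F_2).
Proof. by rewrite -(dvdz_pcharf (pchar_Fp _)). Qed.

Lemma odd_cancel (b a : int) k : ~~ (2 %| b)%Z -> (2 ^+ k %| b * a)%Z = (2 ^+ k %| a)%Z.
Proof.
move=> bo; apply: Gauss_dvdzr; apply: coprimezXl.
by rewrite /coprimez; move: bo; rewrite dvdzE /= -prime_coprime // /coprime => /eqP E; rewrite /gcdz E.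
Qed.

Lemma det_dvd_cols r (W : 'M[int]_r) (d : 'I_r -> int) :
  (forall u j, (d j %| W u j)%Z) -> (\prod_j d j %| \det W)%Z.
Proof.
move=> dW; have -> : W = (\matrix_(u, j) (W u j %/ d j)%Z) *m diag_mx (\row_j d j).
  by apply/matrixP => u j; rewrite mul_mx_diag !mxE divzK.
rewrite det_mulmx det_diag dvdz_mull //.
by rewrite (eq_bigr d) // => j _; rewrite mxE.
Qed.

Section Hm.
Variables (A : comNzRingType) (r : nat) (x v : 'rV[A]_r) (i j0 : 'I_r).

(* Multiplication by this matrix replaces the coordinates of a vector by its
   minors with [x], by its product with [v], and by its [i]-th coordinate. *)
Definition minor_mx : 'M[A]_r := \matrix_(a, j)
  if j == i then (a == i)%:R else if j == j0 then v 0 a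
  else x 0 i * (a == j)%:R - x 0 j * (a == i)%:R.

Lemma minor_mxE (y : 'rV[A]_r) j : (y *m minor_mx) 0 j =
  if j == i then y 0 i else if j == j0 then \sum_a v 0 a * y 0 a
  else x 0 i * y 0 j - x 0 j * y 0 i.
Proof.
have S k : \sum_a y 0 a * (a == k)%:R = y 0 k.
  rewrite (bigD1 k) //= eqxx mulr1 big1 ?addr0 // => a /negbTE ->.
  by rewrite mulr0.
rewrite mxE; under eq_bigr => a _ do rewrite mxE.
case: ifP => _; first exact: S.
case: ifP => _; first by apply: eq_bigr => a _; rewrite mulrC.
rewrite -(S j) -(S i) !mulr_sumr -sumrB; apply: eq_bigr => a _; ring.
Qed.
End Hm.

(* The linear conditions satisfied by all isotropic vectors in the class of [x1];
   the second one is tangency. *)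
Definition lam r (G : 'M[int]_r) f x1 k (y : 'rV[int]_r) : Prop :=
  (forall j, (2 ^+ k %| bil G f x1 * y 0%R j - bil G f y * x1 0%R j)%Z) /\
  (2 ^+ (k + k) %| bil G x1 y)%Z.

Lemma lam_submod r (G : 'M[int]_r) f x1 k : submod (lam G f x1 k).
Proof.
have z y : bil G y 0 = 0 by rewrite -(scale0r 0) bilZr mul0r.
split=> [|a x y [x1k x2k] [y1k y2k]]; first by split=> [j|]; rewrite ?mxE z ?mulr0 ?mul0r ?subrr dvdz0.
split=> [j|]; last by rewrite bilDr bilZr dvdz_add // dvdz_mull.
rewrite !mxE bilDr bilZr.
have -> : bil G f x1 * (a * x 0 j + y 0 j) - (a * bil G f x + bil G f y) * x1 0 j =
  a * (bil G f x1 * x 0 j - bil G f x * x1 0 j) + (bil G f x1 * y 0 j - bil G f y * x1 0 j).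
  by ring.
by rewrite dvdz_add // dvdz_mull.
Qed.

Lemma sum_even_odd (I : finType) (a b : I -> int) :
  (forall j, (2 %| a j)%Z) -> (2 %| \sum_j a j * b j)%Z.
Proof.
by move=> h; apply: (big_ind (fun z => (2 %| z)%Z)) => // [x y|j _]; [exact: dvdz_add|rewrite dvdz_mulr].
Qed.

(** Multiply [Y] by the matrix [H] of odd determinant. Column [i] of the product is unconstrained,
    tangency makes column [j0] divisible by [4^k], and the congruence makes the other [r - 2]
    columns divisible by [2^k]. *)
Lemma lam_det r (G : 'M[int]_r) f x1 k (Y : 'M[int]_r) :
  gram G -> ~~ (2 %| bil G f x1)%Z -> bil G x1 x1 = 0 ->
  (forall u, lam G f x1 k (row u Y)) -> (2 ^+ (k * r) %| \det Y)%Z.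
Proof.
move=> gG bo x10 LY; pose v := x1 *m G.
have vE y : bil G x1 y = \sum_a v 0 a * y 0 a by rewrite bilE.
have [i xi] : exists i, ~~ (2 %| x1 0%R i)%Z.
  apply: contrapT => h; move/negP: bo; apply.
  rewrite bilE; under eq_bigr => j _ do rewrite mulrC.
  by apply: sum_even_odd => j; apply: contrapT => /negP ?; apply: h; exists j.
(* If [v] were even away from [i], isotropy of [x1] would make [v 0 i] even too, hence also
   [bil G f x1]. *)
have [j0 ji vj] : exists2 j0, j0 != i & ~~ (2 %| v 0%R j0)%Z.
  apply: contrapT => h.
  have hv j : j != i -> (2 %| v 0%R j)%Z.
    by move=> ji; apply: contrapT => /negP ?; apply: h; exists j.
  have hvi : (2 %| v 0%R i)%Z.
    have := vE x1; rewrite x10 (bigD1 i) //=.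
    set s := \sum_(_ | _) _ => E.
    have : (2 %| s)%Z.
      by apply: (big_ind (fun z => (2 %| z)%Z)) => // [a b|j ji]; [exact: dvdz_add|rewrite dvdz_mulr ?hv].
    have -> : s = - (x1 0 i * v 0 i) by apply/eqP; rewrite -addr_eq0 addrC mulrC -E.
    by have := odd_cancel (v 0 i) 1 xi; rewrite expr1 => E1; rewrite rpredN E1.
  move/negP: bo; apply; rewrite bilC // vE; apply: sum_even_odd => j.
  by case: (eqVneq j i) => [->|/hv].
pose H := minor_mx x1 v i j0.
(* Modulo 2, a vector killed by [H] vanishes at [i], then away from [j0] through the minors, then at
   [j0] through [v]. *)
have Ho : ~~ (2 %| \det H)%Z.
  rewrite evenF2 -det_map_mx; apply/det0P => -[u u0 uH]; case/eqP: u0.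
  set x' : 'rV['F_2]_r := map_mx intr x1; set v' : 'rV['F_2]_r := map_mx intr v.
  have HE : map_mx intr H = minor_mx x' v' i j0.
    apply/matrixP => a b; rewrite /x' /v' !mxE; case: ifP => _; first by case: (a == i).
    case: ifP => _ //.
    by rewrite rmorphB !rmorphM /=; case: (a == b); case: (a == i).
  have uE j := minor_mxE x' v' i j0 u j; rewrite -HE uH in uE.
  have ui : u 0 i = 0 by have := uE i; rewrite mxE eqxx.
  have uj j : j != j0 -> u 0 j = 0.
    move=> jj; case: (eqVneq j i) => [->//|ji'].
    have := uE j; rewrite mxE (negbTE ji') (negbTE jj) ui mulr0 subr0 => /esym/eqP.
    by rewrite mulf_eq0 mxE -evenF2 (negbTE xi) => /eqP.
  apply/rowP => j; rewrite mxE; case: (eqVneq j j0) => [->|/uj//].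
  have := uE j0; rewrite mxE (negbTE ji) eqxx (bigD1 j0) //= big1 ?addr0 => [/esym/eqP|a /uj ->].
    by rewrite mulf_eq0 mxE -evenF2 (negbTE vj) => /eqP.
  by rewrite mulr0.
have := odd_cancel (\det Y) (k * r) Ho; rewrite mulrC -det_mulmx => <-.
pose d j : int := if j == i then 1 else if j == j0 then 2 ^+ (k + k) else 2 ^+ k.
have -> : 2 ^+ (k * r) = \prod_j d j.
  have -> : 2 ^+ (k * r) = \prod_(j < r) 2 ^+ k :> int.
    by rewrite prodr_const card_ord exprM.
  rewrite (bigD1 i) // (bigD1 j0) //= [RHS](bigD1 i) // [in RHS](bigD1 j0) //=.
  rewrite {1 2}/d eqxx (negbTE ji) eqxx mul1r exprD -mulrA; congr (_ * (_ * _)).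
  by apply: eq_bigr => j /andP [/negbTE ji' /negbTE jj]; rewrite /d ji' jj.
apply: det_dvd_cols => u j.
have -> : (Y *m H) u j = (row u Y *m H) 0 j by rewrite -row_mul [RHS]mxE.
have [L1 L2] := LY u.
rewrite minor_mxE /d; case: eqP => _; first by rewrite dvd1z.
case: eqP => _; first by rewrite -vE.
rewrite -(odd_cancel _ _ bo); set y := row u Y in L1 *.
have -> : bil G f x1 * (x1 0 i * y 0 j - x1 0 j * y 0 i) =
   x1 0 i * (bil G f x1 * y 0 j - bil G f y * x1 0 j)
   + - x1 0 j * (bil G f x1 * y 0 i - bil G f y * x1 0 i) by ring.
by rewrite dvdz_add // dvdz_mull.
Qed.

(** Congruence modulo [2^k] once both vectors are scaled to have the same product with [f];
    cross-multiplication avoids inverting these products, which are odd where this is used. *)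
Definition same_class r (G : 'M[int]_r) f k (x x' : 'rV[int]_r) : Prop :=
  forall j, (2 ^+ k %| bil G f x * x' 0%R j - bil G f x' * x 0%R j)%Z.

(** Expanding the isotropy of the right-hand side shows that [bil G f x * bil G x1 z] is a multiple
    of [2^k]; evenness of [bil G z z] prevents the loss of a factor 2. *)
Lemma class_quot r (G : 'M[int]_r) f k x1 x :
  gram G -> bil G x1 x1 = 0 -> bil G x x = 0 -> ~~ (2 %| bil G f x)%Z ->
  same_class G f k x1 x ->
  exists z, [/\ bil G f x1 *: x = bil G f x *: x1 + 2 ^+ k *: z,
    bil G f z = 0 & (2 ^+ k %| bil G x1 z)%Z].
Proof.
move=> gG x10 x0 fo xx1.
have [z zE] : exists z, bil G f x1 *: x - bil G f x *: x1 = 2 ^+ k *: z.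
  by apply: dvd_row => j; have := xx1 j; rewrite !mxE.
have E : bil G f x1 *: x = bil G f x *: x1 + 2 ^+ k *: z by rewrite -zE addrC subrK.
have k0 : 2 ^+ k != 0 :> int by rewrite expf_neq0.
exists z; split=> //.
  apply: (mulfI k0); rewrite -bilZr -zE bilBr !bilZr; ring.
rewrite -(odd_cancel _ _ fo).
have /dvdzP [c zz] := bil_even z gG.
have := congr1 (fun w => bil G w w) E.
rewrite /= !(bilZl, bilZr, bilDl, bilDr) x10 x0 zz (bilC z x1 gG) => h.
apply/dvdzP; exists (- c).
have k2 : 2 * 2 ^+ k != 0 :> int by rewrite mulf_neq0.
by apply: (mulfI k2); move: h; rewrite !mulr0 add0r; lia.
Qed.

Lemma class_lam r (G : 'M[int]_r) f k x1 x :
  gram G -> bil G x1 x1 = 0 -> bil G x x = 0 ->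
  ~~ (2 %| bil G f x1)%Z -> ~~ (2 %| bil G f x)%Z ->
  same_class G f k x1 x -> lam G f x1 k x.
Proof.
move=> gG x10 x0 fo1 fo xx1; split=> //.
have [z [E _ dz]] := class_quot gG x10 x0 fo xx1.
rewrite -(odd_cancel _ _ fo1) -bilZr E bilDr !bilZr x10 mulr0 add0r exprD.
by rewrite dvdz_mul.
Qed.

(* The cosets of the common kernel by the span of [u] and [w] are disjoint. *)
Lemma card_ker2 r (a1 a2 : 'cV['F_2]_r) (u w : 'rV['F_2]_r) :
  (2 <= r)%N -> u *m a1 = 0 -> u *m a2 = 1 -> w *m a1 = 1 -> w *m a2 = 0 ->
  (#|[set z : 'rV['F_2]_r | (z *m a1 == 0%R) && (z *m a2 == 0%R)]| <= 2 ^ (r - 2))%N.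
Proof.
move=> r2 u1 u2 w1 w2; set K := [set z | _].
pose h (t : 'rV['F_2]_r * bool * bool) := t.1.1 + u *+ t.1.2 + w *+ t.2.
have hin : {in setX (setX K [set: bool]) [set: bool] &, injective h}.
  move=> [[z a] b] [[z' a'] b'] /[!inE] /= /andP [/andP [/andP [/eqP z1 /eqP z2] _] _].
  move=> /andP [/andP [/andP [/eqP z1' /eqP z2'] _] _] hh.
  have := congr1 (mulmx^~ a1) hh; have := congr1 (mulmx^~ a2) hh.
  rewrite /h /= !mulmxDl -!scaler_nat -!scalemxAl z1 z2 z1' z2' u1 u2 w1 w2.
  rewrite !scaler0 !add0r !addr0 => ea eb.
  have aa : a = a' by move: ea => /matrixP /(_ 0 0); rewrite !mxE; case: (a); case: (a').
  have bb : b = b' by move: eb => /matrixP /(_ 0 0); rewrite !mxE; case: (b); case: (b').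
  by move: hh; rewrite /h /= aa bb => /addIr /addIr ->.
have := max_card (mem (h @: setX (setX K [set: bool]) [set: bool])).
rewrite (card_in_imset hin) !cardsX !cardsT card_bool card_mx card_Fp // mul1n.
by rewrite -[X in (_ <= 2 ^ X)%N](subnK r2) expnD -mulnA leq_pmul2r.
Qed.

(** * Points with smooth reduction *)

Lemma size_by_class (R : realType) (A : eqType) (T : finType) (key : A -> T)
    (K : {set T}) (S : seq A) (c : R) :
  (forall x, x \in S -> key x \in K) ->
  (forall k, (size [seq x <- S | key x == k])%:R <= c) ->
  (size S)%:R <= #|K|%:R * c.
Proof.
move=> SK Sc.
have -> : size S = (\sum_(k in K) size [seq x <- S | key x == k])%N.
  elim: S SK {Sc} => [|x S IH] SK; first by rewrite big1.
  rewrite (bigD1 (key x)) ?SK ?inE ?eqxx //= eqxx /= addSn; congr _.+1.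
  rewrite IH => [|y yS]; last by rewrite SK // inE yS orbT.
  rewrite (bigD1 (key x)) ?SK ?inE ?eqxx //=; congr (_ + _)%N.
  by apply: eq_bigr => k /andP [_]; rewrite eq_sym => /negbTE ->.
rewrite natr_sum mulr_natl -sumr_const; exact: ler_sum.
Qed.

Lemma powR_theta (R : realType) r :
  (0 < r)%N -> ((2 ^ r)%N%:R : R) `^ theta R r = (2 ^ (r - 2))%N%:R.
Proof.
move=> r0; rewrite !natrX -!powR_mulrn // -powRrM /theta.
by rewrite mulrCA mulfV ?mulr1 // pnatr_eq0 -lt0n.
Qed.

(** Dividing [x] by [2^r] pays exactly for a splitting into [2^(r-2)] classes. *)
Lemma powR_theta_div (R : realType) r (x : R) : (0 < r)%N -> 0 <= x ->
  (2 ^ (r - 2))%N%:R * (x / (2 ^ r)%N%:R) `^ theta R r = x `^ theta R r.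
Proof.
move=> r0 x0; rewrite -powR_theta // -powRM ?divr_ge0 // mulrC divfK //.
by rewrite pnatr_eq0 expn_eq0.
Qed.

Lemma int_pow2 m : ((2 ^ m)%N : int) = 2 ^+ m.
Proof. by rewrite -natrX pmulrn intz. Qed.

Lemma bil_F2 r (G : 'M[int]_r) f (z : 'rV[int]_r) :
  map_mx intr z *m map_mx intr (f *m G)^T = ((bil G f z)%:~R)%:M :> 'M['F_2]_1.
Proof.
rewrite -map_mxM; apply/matrixP => i j; rewrite !ord1 !mxE /= mulr1n.
by rewrite bilE; congr (_%:~R); apply: eq_bigr => k _; rewrite [in LHS]mxE mulrC.
Qed.

Section TypeB.
Variables (R : realType) (n : nat) (B : 'I_n -> R).
Hypothesis B0 : forall i, 0 < B i.
Variables (r : nat) (C : R).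
Hypotheses (r3 : (3 <= r)%N) (C0 : 0 <= C) (Cs : forall s, (s < r)%N -> @bound R n s C).
Variables (E : 'M[int]_(r, n)) (G : 'M[int]_r) (M : R) (f : 'rV[int]_r).
Hypotheses (gG : gram G) (M0 : 0 <= M) (vE : vol B E M).

(** Induction on [N], the number of levels left before the modulus rules out a spanning class: its
    determinant would be at most [M] and a nonzero multiple of [2^(k*r)]. Otherwise there are at
    most [2^(r-2)] subclasses, each costing [C * (M / 2^(k*r)) ^ theta]: a spanning one by induction
    and [powR_theta_div], so that the factor [2^(r-2)] does not accumulate, any other by
    [drop_rank]. *)
Lemma class_bound N k (S : seq 'rV[int]_r) :
  (0 < k)%N -> M < (2 ^ ((k + N) * r))%N%:R -> uniq S ->
  (forall x, x \in S -> good B E G x) -> spans S ->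
  (forall x, x \in S -> ~~ (2 %| bil G f x)%Z) ->
  (forall x x', x \in S -> x' \in S -> same_class G f k x x') ->
  (size S)%:R <= (2 ^ (r - 2))%N%:R * (C * (M / (2 ^ (k * r))%N%:R) `^ theta R r).
Proof.
elim: N k S => [|N IH] k S k0 MN uS gS spS fo sc.
  have [X X0 XS] := spS; pose x1 := row (Ordinal (ltnW (ltnW r3))) X.
  have x1S : x1 \in S by apply: XS.
  have gZ x : x \in S -> bil G x x = 0 by move=> /gS [].
  have : (2 ^+ (k * r) %| \det X)%Z.
    apply: (@lam_det _ G f x1) => //; [exact: fo|exact: gZ|] => u.
    by apply: class_lam => //; [exact: gZ|exact: gZ|exact: fo|exact: fo|exact: sc].
  rewrite -int_pow2 dvdzE /= => /dvdn_leq; rewrite absz_gt0 => /(_ X0) le.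
  have Xb i : in_box B E (row i X) by case: (gS _ (XS i)).
  have := vol_ge_det B0 Xb M0 vE; rewrite leNgt (lt_le_trans MN) //.
  by rewrite addn0 -abszE -pmulrn ler_nat.
have [X X0 XS] := spS; pose x1 := row (Ordinal (ltnW (ltnW r3))) X.
have x1S : x1 \in S by apply: XS.
have gZ x : x \in S -> bil G x x = 0 by move=> /gS [].
have bo := fo _ x1S.
have [zf zP] : exists zf : 'rV[int]_r -> 'rV[int]_r, forall x, x \in S ->
    [/\ bil G f x1 *: x = bil G f x *: x1 + 2 ^+ k *: zf x,
    bil G f (zf x) = 0 & (2 ^+ k %| bil G x1 (zf x))%Z].
  exists (fun x : 'rV[int]_r => \row_j ((bil G f x1 * x 0%R j - bil G f x * x1 0%R j) %/ 2 ^+ k)%Z).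
  move=> x xS; have [z [zE fz dz]] :=
    class_quot gG (gZ _ x1S) (gZ _ xS) (fo _ xS) (sc _ _ x1S xS).
  have -> // : \row_j ((bil G f x1 * x 0%R j - bil G f x * x1 0%R j) %/ 2 ^+ k)%Z = z.
  apply/rowP => j; rewrite mxE; move/rowP/(_ j): zE; rewrite !mxE => ->.
  by rewrite addrAC subrr add0r mulKz // expf_neq0.
pose a1 : 'cV['F_2]_r := map_mx intr (f *m G)^T.
pose a2 : 'cV['F_2]_r := map_mx intr (x1 *m G)^T.
pose key (x : 'rV[int]_r) : 'rV['F_2]_r := map_mx intr (zf x).
pose K := [set z : 'rV['F_2]_r | (z *m a1 == 0) && (z *m a2 == 0)].
have ev a : (2 %| a)%Z -> (a%:~R)%:M = 0 :> 'M['F_2]_1.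
  by rewrite evenF2 => /eqP ->; apply/matrixP => i j; rewrite !mxE mul0rn.
have od a : ~~ (2 %| a)%Z -> (a%:~R)%:M = 1 :> 'M['F_2]_1.
  rewrite evenF2 => h; congr (_%:M); move: h; case: (_%:~R) => [[|[|//]] i] // _.
  exact: val_inj.
have K2 : (#|K| <= 2 ^ (r - 2))%N.
  (* The images of [f] and [x1] are dual to the two functionals: [bil G f f] is even, [bil G x1 x1]
     is zero and [bil G f x1] is odd. *)
  apply: (@card_ker2 _ a1 a2 (map_mx intr f) (map_mx intr x1)); first exact: ltnW.
  - by rewrite bil_F2 ev // bil_even.
  - by rewrite bil_F2 od // bilC.
  - by rewrite bil_F2 od.
  - by rewrite bil_F2 ev // gZ.
apply: (@le_trans _ _ (#|K|%:R * (C * (M / (2 ^ (k * r))%N%:R) `^ theta R r))); last first.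
  by apply: ler_wpM2r; [rewrite mulr_ge0 // powR_ge0|rewrite ler_nat].
apply: (@size_by_class _ _ _ key) => [x xS|c].
  have [_ fz dz] := zP _ xS; rewrite inE !bil_F2 !ev ?fz ?eqxx //.
  by apply: dvdz_trans dz; rewrite -(prednK k0) exprS dvdz_mulr.
set Sc := [seq x <- S | _].
have ScS x : x \in Sc -> x \in S by rewrite mem_filter => /andP [].
have uSc : uniq Sc by exact: filter_uniq.
have gSc x : x \in Sc -> good B E G x by move/ScS/gS.
case: (pselect (spans Sc)) => spSc.
  have := IH k.+1 Sc isT; rewrite addSnnS => /(_ MN uSc gSc spSc).
  have fo' x : x \in Sc -> ~~ (2 %| bil G f x)%Z by move/ScS/fo.
  move=> /(_ fo') h; apply: le_trans (h _) _ => {h}.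
    move=> x x'; rewrite !mem_filter => /andP [/eqP kx xS] /andP [/eqP kx' x'S] j.
    have [xE _ _] := zP _ xS; have [x'E _ _] := zP _ x'S.
    rewrite -(odd_cancel _ _ bo).
    (* The multiples of [x1] cancel. The cofactor of [2^k] is even, as [zf x] and [zf x'] agree
       modulo 2 and both products with [f] are odd. *)
    have -> : bil G f x1 * (bil G f x * x' 0 j - bil G f x' * x 0 j) =
        2 ^+ k * (bil G f x * zf x' 0 j - bil G f x' * zf x 0 j).
      move/rowP/(_ j): xE; move/rowP/(_ j): x'E; rewrite !mxE => e' e.
      rewrite mulrBr mulrCA e' [X in _ - X]mulrCA e; ring.
    rewrite exprSr dvdz_mul //.
    have kj : (zf x 0 j)%:~R = (zf x' 0 j)%:~R :> 'F_2.
      have /rowP /(_ j) : key x = key x' by rewrite kx kx'.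
      by rewrite !mxE.
    have F2 (a : 'F_2) : a != 0 -> a = 1.
      by case: a => [[|[|//]] i] // _; exact: val_inj.
    have := fo _ xS; have := fo _ x'S; rewrite !evenF2 rmorphB !rmorphM /= kj.
    by move=> /F2 -> /F2 ->; rewrite subrr.
  have -> : M / (2 ^ (k.+1 * r))%N%:R = M / (2 ^ (k * r))%N%:R / (2 ^ r)%N%:R.
    by rewrite mulSn addnC expnD natrM invfM mulrA.
  rewrite mulrCA powR_theta_div //.
    exact: ltnW (ltnW r3).
  by rewrite divr_ge0.
have Xb i : in_box B E (row i X) by case: (gS _ (XS i)).
have SL x : x \in S -> lam G f x1 k x.
  by move=> xS; apply: class_lam => //; [exact: gZ|exact: gZ|exact: fo|exact: sc].
apply: (drop_rank B0 C0 Cs gG M0 vE uSc gSc X0 Xb (lam_submod G f x1 k)) => //.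
- by move=> i; apply: SL.
- by move=> x /ScS /SL.
- by rewrite expn_gt0.
- by move=> Y LY; rewrite int_pow2; apply: lam_det LY => //; exact: gZ.
Qed.
End TypeB.

(** * Arbitrary reduction *)

(** Repeated halving lowers the sum of the absolute values of the entries. The negated condition
    says that 2 does not divide the form of [G'], whose coefficients are the off-diagonal entries
    and half the diagonal ones. *)
Lemma gram_primitive r (G : 'M[int]_r) : gram G -> G != 0 ->
  exists c G', [/\ c != 0, gram G', G = c *: G' &
    ~ ((forall i j, (2 %| G' i j)%Z) /\ forall i, (4 %| G' i i)%Z)].
Proof.
pose m (G : 'M[int]_r) := (\sum_i \sum_j `|G i j|)%N.
have [N] := ubnP (m G); elim: N => // N IH in G *; rewrite ltnS => mN gG G0.
case: (pselect ((forall i j, (2 %| G i j)%Z) /\ forall i, (4 %| G i i)%Z)); last first.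
  by move=> h; exists 1, G; rewrite scale1r.
move=> [e2 e4]; have [G' gG' GE] := gram_half (isT : 2 != 0 :> int) e2 e4 (proj1 gG).
have G'0 : G' != 0 by apply: contraNneq G0 => G'0; rewrite GE G'0 scaler0.
have mE : m G = (2 * m G')%N.
  rewrite /m big_distrr; apply: eq_bigr => i _; rewrite big_distrr; apply: eq_bigr => j _.
  by rewrite GE mxE abszM.
have m0 : (0 < m G')%N.
  rewrite lt0n; apply: contra G'0; rewrite sum_nat_eq0 => /forallP h.
  apply/eqP/matrixP => i j; have := h i; rewrite sum_nat_eq0 => /forallP /(_ j).
  by rewrite mxE absz_eq0 => /eqP.
have [|c [G'' [c0 gG'' G'E np]]] := IH G' _ gG' G'0; first by lia.
by exists (2 * c), G''; split=> //; rewrite ?mulf_neq0 // GE G'E scalerA.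
Qed.

(** The singular zeros modulo 2 of the form [q]: its gradient vanishes and [q y] is even. In
    characteristic 2 the first condition does not imply the second. *)
Definition singular r (G : 'M[int]_r) (y : 'rV[int]_r) : Prop :=
  (forall i, (2 %| bil G (delta_mx 0%R i) y)%Z) /\ (4 %| bil G y y)%Z.

Lemma singular_even r (G : 'M[int]_r) x y : singular G y -> (2 %| bil G x y)%Z.
Proof.
move=> [y2 _].
rewrite -[x]mulmx1; apply: (@submod_mul _ _ (fun t => (2 %| bil G t y)%Z)) => [|i].
  split=> [|b u v ue ve]; first by rewrite -(scale0r 0) bilZl mul0r.
  by rewrite bilDl bilZl dvdz_add // dvdz_mull.
by rewrite row1.
Qed.

Lemma singular_submod r (G : 'M[int]_r) : gram G -> submod (singular G).
Proof.
move=> gG; split=> [|a x y [x2 x4] sy].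
  have z y : bil G y 0 = 0 by rewrite -(scale0r 0) bilZr mul0r.
  by split=> [i|]; rewrite z.
have xy := singular_even x sy; have [y2 y4] := sy.
split=> [i|]; first by rewrite bilDr bilZr dvdz_add // dvdz_mull.
have -> : bil G (a *: x + y) (a *: x + y) =
   a * a * bil G x x + (2 * (2 * (bil G x y %/ 2)%Z) * a + bil G y y).
  rewrite [2 * (_ %/ _)%Z]mulrC divzK // !(bilDl, bilDr, bilZl, bilZr) (bilC y x gG).
  ring.
rewrite dvdz_add ?dvdz_mull // dvdz_add // dvdz_mulr // mulrA.
exact: (@dvdz_mulr 4 (2 * 2)).
Qed.

(** If [\det F] were odd, then for any [z] the vector [\det F *: z], in the row span of [F], would
    be singular, hence [z] as well, and 2 would divide the form. *)
Lemma singular_det r (G F : 'M[int]_r) :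
  gram G -> ~ ((forall i j, (2 %| G i j)%Z) /\ forall i, (4 %| G i i)%Z) ->
  (forall u, singular G (row u F)) -> (2 %| \det F)%Z.
Proof.
move=> gG np sF; apply: contrapT => /negP Fo; apply: np.
have sing z : singular G z.
  have : singular G (\det F *: z).
    rewrite -mul_mx_scalar -mul_adj_mx mulmxA.
    exact: submod_mul (singular_submod gG) sF.
  case=> h2 h4; split=> [i|].
    have := odd_cancel (bil G (delta_mx 0 i) z) 1 Fo; rewrite expr1 => <-.
    by rewrite -bilZr.
  have E (a : int) : (4 %| \det F * a)%Z = (4 %| a)%Z := odd_cancel a 2 Fo.
  by move: h4; rewrite bilZl bilZr !E.
split=> [i j|i]; rewrite -bil_delta; [exact: (proj1 (sing _))|exact: (proj2 (sing _))].
Qed.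

Section TypeA.
Variables (R : realType) (n r : nat) (C0 : R).
Hypotheses (r3 : (3 <= r)%N) (C0_ge0 : 0 <= C0).
Hypothesis Cs : forall s, (s < r)%N -> @bound R n s C0.

(** [D] covers what is counted without halving [M]: the [2^r] residue classes of smooth points, each
    spanning or degenerate, and singular points of smaller span. [rho] is the gain from halving
    [M]. *)
Let D := (2 ^ r)%N%:R * ((2 ^ (r - 2))%N%:R * C0 + C0) + C0.
Let rho : R := 2^-1 `^ theta R r.

(** Spanning points of one residue class modulo 2 share a unit vector [f] with [bil G f x] odd, so
    [class_bound] starts at level 1. The points [S0] complete bases inside the box, since [S] may
    not span. *)
Lemma nonsingular_bound (B : 'I_n -> R) (E : 'M[int]_(r, n)) (G : 'M[int]_r)
    (S S0 : seq 'rV[int]_r) (M : R) :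
  (forall i, 0 < B i) -> gram G -> 0 <= M -> vol B E M -> uniq S ->
  (forall x, x \in S -> good B E G x) -> spans S0 -> (forall x, x \in S0 -> good B E G x) ->
  (forall x, x \in S -> exists i, ~~ (2 %| bil G (delta_mx 0%R i) x)%Z) ->
  (size S)%:R <= (2 ^ r)%N%:R * (((2 ^ (r - 2))%N%:R * C0 + C0) * M `^ theta R r).
Proof.
move=> B0 gG M0 vE uS gS [X X0 XS0] gS0 ns.
have Xb i : in_box B E (row i X) by case: (gS0 _ (XS0 i)).
have Mt : 0 <= M `^ theta R r by exact: powR_ge0.
pose key (x : 'rV[int]_r) : 'rV['F_2]_r := map_mx intr x.
have -> : (2 ^ r)%N%:R = #|[set: 'rV['F_2]_r]|%:R :> R.
  by rewrite cardsT card_mx card_Fp // mul1n.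
apply: (@size_by_class _ _ _ key) => [x _|c]; first by rewrite inE.
set Sc := [seq x <- S | _].
have ScS x : x \in Sc -> x \in S by rewrite mem_filter => /andP [].
have uSc : uniq Sc by exact: filter_uniq.
have gSc x : x \in Sc -> good B E G x by move/ScS/gS.
case: (pselect (spans Sc)) => spSc; last first.
  have := drop_rank (q := 1) B0 C0_ge0 Cs gG M0 vE uSc gSc X0 Xb
    (Lam := fun=> True) _ _ _ isT _ spSc.
  rewrite divr1 => h; apply: le_trans (h _ _ _ _) _ => //.
  by apply: ler_wpM2r => //; rewrite lerDr mulr_ge0.
have [Y Y0 YS] := spSc; pose x0 := row (Ordinal (ltnW (ltnW r3))) Y.
have x0S : x0 \in Sc by exact: YS.
have [i fo] := ns _ (ScS _ x0S); pose f : 'rV[int]_r := delta_mx 0 i.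
have kE x : x \in Sc -> key x = key x0.
  by move: x0S; rewrite !mem_filter => /andP [/eqP -> _] /andP [/eqP -> _].
have fE x : x \in Sc -> (bil G f x)%:~R = (bil G f x0)%:~R :> 'F_2.
  move=> xS; have /matrixP /(_ 0 0) : ((bil G f x)%:~R)%:M = ((bil G f x0)%:~R)%:M :> 'M['F_2]_1.
    by rewrite -!bil_F2 -/(key x) kE.
  by rewrite !mxE.
have fo' x : x \in Sc -> ~~ (2 %| bil G f x)%Z by move=> xS; rewrite evenF2 fE // -evenF2.
have [N MN] : exists N, M < (2 ^ ((1 + N) * r))%N%:R.
  exists (Num.bound M); apply: lt_le_trans (archi_boundP M0) _.
  rewrite ler_nat; apply: leq_trans (ltnW (ltn_expl _ (ltnSn 1))) _.
  by rewrite leq_exp2l // mulSn; have := r3; nia.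
have := class_bound B0 r3 C0_ge0 Cs gG M0 vE (f := f) (k := 1%N) isT MN uSc gSc spSc fo'.
move=> h; apply: le_trans (h _) _ => {h}.
  move=> x x' xS x'S j; rewrite expr1 evenF2 rmorphB !rmorphM /= !fE //.
  have kj y : y \in Sc -> (y 0 j)%:~R = (x0 0 j)%:~R :> 'F_2.
    by move=> /kE /rowP /(_ j); rewrite !mxE.
  by rewrite !kj // subrr.
rewrite mulrDl -mulrA -[X in X <= _]addr0; apply: lerD; last by rewrite mulr_ge0.
apply: ler_wpM2l => //; apply: ler_wpM2l => //.
apply: ge0_ler_powR; rewrite ?theta_ge0 // ?nnegrE ?divr_ge0 //.
by rewrite ler_pdivrMr ?ltr0n ?expn_gt0 // ler_peMr // ler1n expn_gt0.
Qed.

Lemma rho_lt1 : rho < 1.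
Proof.
have t0 : 0 < theta R r.
  by rewrite /theta divr_gt0 ?ltr0n ?subn_gt0 //; exact: ltnW (ltnW r3).
have e1 : 1 `^ theta R r = 1 :> R by rewrite powR1.
rewrite /rho -[ltRHS]e1; apply: gt0_ltr_powR => //.
all: by rewrite ?nnegrE ?invr_ge0 ?invf_lt1 ?ltr1n.
Qed.

Lemma bound_step : exists2 C, C0 <= C & @bound R n r C.
Proof.
have r0 : 0 <= rho by exact: powR_ge0.
have r1 : 0 < 1 - rho by rewrite subr_gt0 rho_lt1.
have D0 : C0 <= D by rewrite lerDr mulr_ge0 // addr_ge0 // mulr_ge0.
(* The sum of the geometric series, that is the solution of [D + C * rho = C]. *)
pose C := D / (1 - rho).
have DC : D + C * rho = C by rewrite /C; field; rewrite gt_eqF.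
have D_le_C : D <= C.
  rewrite -DC lerDl mulr_ge0 // divr_ge0 ?(ltW r1) //; exact: le_trans D0.
have C_ge0 : 0 <= C by apply: le_trans D_le_C; exact: le_trans D0.
exists C; first exact: le_trans D_le_C.
(* Induction on a dyadic bound for [M], halved at each passage to the singular sublattice; for
   [M < 1] the points cannot span. *)
suff main N : forall (B : 'I_n -> R) (E : 'M[int]_(r, n)) (G : 'M[int]_r)
    (S : seq 'rV[int]_r) (M : R), M < (2 ^ N)%N%:R ->
    (forall i, 0 < B i) -> gram G -> 0 <= M -> vol B E M -> uniq S ->
    (forall x, x \in S -> good B E G x) -> spans S ->
    (size S)%:R <= C * M `^ theta R r.
  move=> B E G S M B0 gG M0; apply: (main (Num.bound M)) => //.
  by apply: lt_trans (archi_boundP M0) _; rewrite ltr_nat ltn_expl.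
elim: N => [|N IH] B E G S M MN B0 gG M0 vE uS gS spS.
  have [X X0 XS] := spS.
  have Xb i : in_box B E (row i X) by case: (gS _ (XS i)).
  have := vol_ge_det B0 Xb M0 vE; rewrite leNgt (lt_le_trans MN) //.
  by rewrite expn0 ler1z -gtz0_ge1 normr_gt0.
have [X X0 XS] := spS.
have Xb i : in_box B E (row i X) by case: (gS _ (XS i)).
(* For the zero form every plane is isotropic, so a unit vector not parallel to [x] contradicts
   [good]. *)
have G0 : G != 0.
  apply/eqP => G0; pose x := row (Ordinal (ltnW (ltnW r3))) X.
  have [_ px _ NL] := gS x (XS _).
  have b0 u v : bil G u v = 0 by rewrite /bil G0 mulmx0 mul0mx mxE.
  have [i xi] := rv_neq0P (prim_neq0 px).
  have [j ji] : exists j : 'I_r, j != i.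
    have [->|i0] := eqVneq i (Ordinal (ltnW (ltnW r3))); first by exists (Ordinal (ltnW r3)).
    by exists (Ordinal (ltnW (ltnW r3))); rewrite eq_sym.
  have := NL (delta_mx 0 j) (b0 _ _) (b0 _ _) i j.
  have ej k : (delta_mx 0 j : 'rV[int]_r) 0 k = (k == j)%:R by rewrite mxE eqxx.
  by rewrite !ej eqxx eq_sym (negbTE ji) mulr1 mulr0 => /eqP; rewrite (negbTE xi).
have [c [G' [c0 gG' GE np]]] := gram_primitive gG G0.
have {}gS x : x \in S -> good B E G' x.
  move=> /gS gx; rewrite -[E]mul1mx; apply: (good_sub (G := G) _ c0); rewrite ?mulmx1 //.
    by rewrite map_mx1 row_free_unit unitmx1.
  by rewrite mul1mx trmx1 mulmx1.
pose sg x := `[< singular G' x >].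
pose S1 := [seq x <- S | sg x]; pose S2 := [seq x <- S | ~~ sg x].
have sz : size S = (size S1 + size S2)%N by rewrite !size_filter count_predC.
have S1S x : x \in S1 -> x \in S by rewrite mem_filter => /andP [].
have S2S x : x \in S2 -> x \in S by rewrite mem_filter => /andP [].
have b2 : (size S2)%:R <= (2 ^ r)%N%:R * (((2 ^ (r - 2))%N%:R * C0 + C0) * M `^ theta R r).
  apply: (nonsingular_bound B0 gG' M0 vE _ _ spS gS) => [|x /S2S /gS //|x].
    exact: filter_uniq.
  rewrite mem_filter => /andP [/asboolP nsx /gS [_ _ x0 _]].
  (* Isotropy gives the condition modulo 4, so it is the gradient that does not vanish. *)
  apply: contrapT => h; apply: nsx; split=> [i|]; last by rewrite x0.
  by apply: contrapT => /negP ?; apply: h; exists i.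
have uS1 : uniq S1 by exact: filter_uniq.
have gS1 x : x \in S1 -> good B E G' x by move/S1S/gS.
have b1 : (size S1)%:R <= C0 * M `^ theta R r \/ (size S1)%:R <= C * rho * M `^ theta R r.
  have := drop_or_full (q := 1) B0 C0_ge0 Cs gG' M0 vE uS1 gS1 X0 Xb
    (Lam := fun=> True) _ _ _ isT _.
  rewrite divr1 => h; case: h => // [h|[F [S' [Ff SE sp' FL]]]]; first by left.
  right.
  have sF u : singular G' (row u F).
    apply: FL => [|x]; first exact: singular_submod.
    by rewrite mem_filter => /andP [/asboolP].
  have dF := singular_det gG' np sF.
  have dF0 : \det F != 0 by rewrite -det_mxQ -unitfE -unitmxE -row_free_unit.
  have FGE i j : (F *m G' *m F^T) i j = bil G' (row i F) (row j F).
    by rewrite -bil_delta bilM -!rowE.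
  (* On the singular sublattice the form is divisible by 2, and halving it keeps the points good. *)
  have [|i|G'' gG'' G''E] := gram_half (isT : 2 != 0 :> int) _ _ (proj1 (gram_sub F gG')).
  - by move=> i j; rewrite FGE; exact: singular_even.
  - by rewrite FGE; exact: (proj2 (sF i)).
  have gS' t : t \in S' -> good B (F *m E) G'' t.
    move=> tS'; apply: (good_sub (G := G') Ff (isT : 2 != 0 :> int) G''E).
    by apply: gS1; rewrite -SE; apply: map_f.
  have vF : vol B (F *m E) (M / 2).
    apply: (vol_mul (q := 2)) => //.
    by move: dF; rewrite dvdzE => /dvdn_leq; apply; rewrite absz_gt0.
  have M2 : 0 <= M / 2 by rewrite divr_ge0.
  have MN' : M / 2 < (2 ^ N)%N%:R.
    by rewrite ltr_pdivrMr // -natrM -expnSr.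
  have uS' : uniq S' by move: uS1; rewrite -SE; apply: map_uniq.
  have := IH B (F *m E) G'' S' (M / 2) MN' B0 gG'' M2 vF uS' gS' sp'.
  by rewrite -SE size_map powRM ?invr_ge0 // mulrA mulrAC.
rewrite sz natrD; apply: (@le_trans _ _ (D * M `^ theta R r + C * rho * M `^ theta R r)).
  rewrite /D mulrDl -addrA [X in X <= _]addrC; apply: lerD; first by rewrite -mulrA.
  have Mt : 0 <= M `^ theta R r by exact: powR_ge0.
  case: b1 => h; apply: le_trans h _.
    by rewrite lerDl (mulr_ge0 (mulr_ge0 C_ge0 r0) Mt).
  by rewrite lerDr mulr_ge0.
by rewrite -mulrDl DC.
Qed.
End TypeA.

Lemma bound_all (R : realType) n r : exists2 C : R, 0 <= C & forall s, (s <= r)%N -> @bound R n s C.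
Proof.
elim: r => [|r [C C0 hC]].
  exists 4 => // s; rewrite leqn0 => /eqP ->; exact: bound_small.
case: (ltnP r.+1 3) => r3.
  exists 4 => // s sr; apply: bound_small; exact: leq_trans sr _.
have [C' CC' hC'] := bound_step r3 C0 hC.
exists C'; first exact: le_trans CC'.
move=> s; rewrite leq_eqVlt => /orP [/eqP -> //|/hC]; exact: bound_le.
Qed.

(** * Quadratic polynomials *)

Lemma mdeg2P n (m : multinom n) : mdeg m = 2%N ->
  exists i j, m = mnm_add (mnm1 i) (mnm1 j).
Proof.
move=> m2; have [i mi] : exists i : 'I_n, m i != 0%N.
  apply/existsP; rewrite -negb_forall; apply/negP => /forallP h.
  by move: m2; rewrite mdegE big1 // => i _; apply/eqP.
have mE := submK (m := mnm1 i) (m' := m); rewrite lep1mP in mE.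
have := m2; rewrite -{1}(mE mi) mdegD mdeg1 addn1 => -[/eqP/mdeg1P [j /eqP jE]].
by exists j, i; rewrite -jE mE.
Qed.

(** A monomial [c x_i x_j] contributes [c *: (delta_mx i j + delta_mx j i)]. The identity is used
    over the integers for the points and over [algC] for the lines. *)
Lemma form_gram n (Q : mpoly n int) : quadratic_form Q ->
  exists2 G, gram G & forall (A : comNzRingType) (v : 'rV[A]_n),
    2 * form_eval Q v = (v *m map_mx intr G *m v^T) 0 0.
Proof.
move=> /dhomogP homQ; rewrite /form_eval /mmap.
have : forall m, m \in msupp Q -> mdeg m = 2%N by exact: homQ.
elim: (msupp Q : seq _) => [|m s IH] hs.
  exists 0 => [|A v]; first by split=> [|i]; rewrite ?trmx0 ?mxE.
  by rewrite big_nil map_mx0 mulmx0 mul0mx mxE mulr0.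
have [G' [G's G'd] G'E] := IH (fun m' m's => hs m' (mem_behead (s := m :: s) m's)).
have [i [j mE]] := mdeg2P (hs m (mem_head _ _)).
pose c := mcoeff m Q.
exists (c *: (delta_mx i j + delta_mx j i) + G').
  split=> [|k].
    apply/matrixP => a b; rewrite !mxE -[in RHS]G's [in RHS]mxE.
    by congr (_ * _ + _); rewrite addrC; congr (_%:R + _%:R); rewrite andbC.
  rewrite !mxE rpredD // andbC mulrDr.
  case: (_ && _); rewrite ?mulr0 ?addr0 // mulr1 -mulr2n -[c *+ 2]mulr_natl.
  exact: dvdz_mulr.
move=> A v; rewrite big_cons mulrDr G'E.
have -> : mmap1 (fun i => v 0 i) m = v 0 i * v 0 j.
  rewrite {1}mE commr_mmap1_M ?mmap1U // => k z; exact: mulrC.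
rewrite map_mxD map_mxZ map_mxD !map_delta_mx mulmxDr mulmxDl [RHS]mxE; congr (_ + _).
rewrite -scalemxAr -scalemxAl [RHS]mxE mulmxDr mulmxDl [X in _ = _ * X]mxE.
have d k l : (v *m delta_mx k l *m v^T) 0 0 = v 0 k * v 0 l.
  rewrite -(mul_delta_mx (0 : 'I_1)) mulmxA -colE -mulmxA -rowE.
  by rewrite mxE big_ord1 !mxE.
by rewrite !d; ring.
Qed.

(** * From points off the rational lines to good lattice vectors *)

Lemma primitive_prim n (x : 'rV[int]_n) : primitive x -> prim x.
Proof.
move=> /eqP px d y xE; apply/eqP; rewrite -dvdn1 -px.
apply: (big_ind (fun z => `|d| %| z)%N) => [|a b|i _]; first exact: dvdn0.
  by move=> da db; rewrite dvdn_gcd da.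
by rewrite xE mxE abszM dvdn_mulr.
Qed.

(** The Gram matrix of [x] and [y] vanishes, so the form is zero on every algebraic combination of
    them. This turns the exclusion of rational lines into the last clause of [good]. *)
Lemma line_of_plane n (Q : mpoly n int) G (x y : 'rV[int]_n) :
  (forall (A : comNzRingType) (v : 'rV[A]_n),
    2 * form_eval Q v = (v *m map_mx intr G *m v^T) 0 0) -> gram G ->
  bil G x x = 0 -> bil G x y = 0 -> bil G y y = 0 -> ~ par x y ->
  exists L : 'M[rat]_(2, n),
    rational_line_in Q L /\ on_line L (map_mx (intr : int -> algC) x).
Proof.
move=> GE gG xx xy yy nxy.
pose Lz : 'M[int]_(2, n) := \matrix_(i, j) (if i == 0 then x 0 j else y 0 j).
have rowL i : row i Lz = if i == 0 then x else y.
  by apply/rowP => j; rewrite !mxE; case: ifP.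
have LG : Lz *m G *m Lz^T = 0.
  apply/matrixP => i j; rewrite [RHS]mxE -bil_delta bilM -!rowE !rowL.
  by case: ifP; case: ifP => // _ _; rewrite bilC.
have LC : map_mx (ratr : rat -> algC) (mxQ Lz) = map_mx intr Lz.
  by apply/matrixP => i j; rewrite !mxE ratr_int.
exists (mxQ Lz); split; last first.
  rewrite /on_line LC.
  have -> : map_mx (intr : int -> algC) x = row 0 (map_mx intr Lz) by rewrite -map_row rowL.
  exact: row_sub.
split=> [|v v0].
  apply/eqP/inj_row_free => w /rowP wL.
  have E k : w 0 0 * (x 0 k)%:~R + w 0 1 * (y 0 k)%:~R = 0.
    have e1 : lift ord0 ord0 = 1 :> 'I_2 by exact: val_inj.
    by have := wL k; rewrite !mxE big_ord_recl big_ord1 e1 !mxE.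
  have [i [j ij]] : exists i j, x 0 i * y 0 j - x 0 j * y 0 i != 0.
    apply: contrapT => h; apply: nxy => i j; apply/eqP; rewrite -subr_eq0.
    by apply: contrapT => /negP ?; apply: h; exists i, j.
  have ijQ : (x 0 i)%:~R * (y 0 j)%:~R - (x 0 j)%:~R * (y 0 i)%:~R != 0 :> rat.
    by rewrite -!rmorphM -rmorphB /= intr_eq0.
  have w0 : w 0 0 = 0.
    apply: (mulIf ijQ); rewrite mul0r.
    have -> : w 0 0 * ((x 0 i)%:~R * (y 0 j)%:~R - (x 0 j)%:~R * (y 0 i)%:~R) =
      (y 0 j)%:~R * (w 0 0 * (x 0 i)%:~R + w 0 1 * (y 0 i)%:~R)
      - (y 0 i)%:~R * (w 0 0 * (x 0 j)%:~R + w 0 1 * (y 0 j)%:~R) :> rat by ring.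
    by rewrite !E !mulr0 subrr.
  have w1 : w 0 1 = 0.
    apply: (mulIf ijQ); rewrite mul0r.
    have -> : w 0 1 * ((x 0 i)%:~R * (y 0 j)%:~R - (x 0 j)%:~R * (y 0 i)%:~R) =
      (x 0 i)%:~R * (w 0 0 * (x 0 j)%:~R + w 0 1 * (y 0 j)%:~R)
      - (x 0 j)%:~R * (w 0 0 * (x 0 i)%:~R + w 0 1 * (y 0 i)%:~R) :> rat by ring.
    by rewrite !E !mulr0 subrr.
  apply/rowP => k; rewrite mxE.
  by case: (unliftP 0 k) => [k' ->|->] //; rewrite ord1 -[RHS]w1; congr (w _ _); apply: val_inj.
rewrite /on_line LC => /submxP [w vE].
have : 2 * form_eval Q v = 0.
  have LGC : map_mx intr Lz *m map_mx intr G *m (map_mx intr Lz)^T = 0 :> 'M[algC]_2.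
    have -> : (map_mx intr Lz)^T = map_mx intr Lz^T :> 'M[algC]_(n, 2).
      by apply/matrixP => i j; rewrite !mxE.
    by rewrite -!map_mxM LG map_mx0.
  rewrite GE; have -> : v *m map_mx intr G *m v^T =
      w *m (map_mx intr Lz *m map_mx intr G *m (map_mx intr Lz)^T) *m w^T.
    by rewrite vE trmx_mul !mulmxA.
  by rewrite LGC mulmx0 mul0mx mxE.
by move/eqP; rewrite mulf_eq0 pnatr_eq0 => /eqP.
Qed.

Theorem theorem1p2 (R : realType) (n : nat) (hn : (3 <= n)%N) :
  exists C : R,
    forall (B : 'I_n -> R) (Q : mpoly n int),
      (forall i : 'I_n, 1 <= B i) ->
      quadratic_form Q ->
      (N1 Q B)%:R <= C * (\prod_(i < n) B i) `^ ((n%:R - 2) / n%:R).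
Proof.
have [C C0 hC] := bound_all R n n.
(* The second factor comes from the factorial in [vol], which enters [M]. *)
exists (C * (n`!)%:R `^ theta R n) => B Q B1 qQ.
have B0 i : 0 < B i by apply: lt_le_trans (B1 i).
have [G gG GE] := form_gram qQ.
rewrite /N1; set F := fset_set _.
have gS x : x \in enum_fset F -> good B 1%:M G x.
  rewrite -/(x \in F) in_fset_set; last exact: N1_set_finite.
  move=> /classical_sets.set_mem [px xB x0 nl].
  have xx : bil G x x = 0.
    have := GE int x; rewrite x0 mulr0 => /esym.
    have -> : map_mx intr G = G by apply/matrixP => i j; rewrite mxE intz.
    by [].
  split=> //; first by move=> j; rewrite mulmx1.
  - exact: primitive_prim.
  - move=> y xy yy; apply: contrapT => nxy; apply: nl.
    exact: line_of_plane GE gG xx xy yy nxy.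
have V0 : 0 <= \prod_i B i by apply: prodr_ge0 => i _; exact: ltW.
pose M := (n`!)%:R * \prod_i B i.
have M0 : 0 <= M by rewrite mulr_ge0.
have vE : vol B 1%:M M.
  exists id; rewrite (_ : colsub id 1%:M = 1%:M) ?det1 ?normr1 ?mulr1 //.
  by apply/matrixP => i j; rewrite mxE.
have uS : uniq (enum_fset F) by exact: fset_uniq.
have main : (size (enum_fset F))%:R <= C * M `^ theta R n.
  case: (pselect (spans (enum_fset F))) => sp.
    exact: (hC n (leqnn n) B 1%:M G).
  (* As [B j >= 1], the unit vectors lie in the box and can complete the basis of a smaller span. *)
  have Xb i : in_box B 1%:M (row i (1%:M : 'M[int]_n)).
    move=> j; rewrite mulmx1 !mxE; apply: le_trans (B1 j).
    by case: (i == j); rewrite ?normr1 ?normr0.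
  have := drop_rank (q := 1) B0 C0 (fun s sn => hC s (ltnW sn)) gG M0 vE uS gS
    (X := 1%:M) _ Xb (Lam := fun=> True) _ _ _ isT _ sp.
  by rewrite divr1 => h; apply: h => //; rewrite ?det1 // => Y _; rewrite dvd1z.
apply: le_trans main _.
have <- : theta R n = (n%:R - 2) / n%:R by rewrite /theta natrB // ltnW.
by rewrite -mulrA -powRM.
Qed.
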